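(* For every real number $c<-2$, the non-wandering set $\mathcal{NW}(f_c)$ of the map $f_c:\mathbb{R}\to\mathbb{R}$, $f_c(x)=x^2+c$, is hyperbolic (for $f_c$).
   Context: Here $\mathbb{N}=\{1,2,3,\dots\}$, and $f^{n}$ denotes the $n$-fold composition of $f$ with itself. Non-wandering set: for a continuous map $f:\mathbb{R}\to\mathbb{R}$, $\mathcal{NW}(f):=\{x\in\mathbb{R} : \text{for every neighbourhood } U \text{ of } x \text{ there is } n\in\mathbb{N} \text{ with } f^{n}(U)\cap U\neq\emptyset\}$. Hyperbolicity: let $f:\mathbb{R}\to\mathbb{R}$ be smooth and let $M\subset\mathbb{R}$ be an $f$-invariant set, meaning $f(M)\subset M$. For $x\in M$ the tangent space at $x$ is taken to be $T_x=T_x\mathbb{R}=\mathbb{R}$, and $D_xf: T_x\to T_{f(x)}$ is multiplication by $f'(x)$. The set $M$ is called hyperbolic if there exist constants $K,C>0$ and $\Lambda>1$ such that, with $$E_x^s:=\{v\in T_x : |(D_xf^{n})v|\le K\Lambda^{-n}|v| \text{ for all } n\in\mathbb{N}\},\qquad E_x^u:=\{v\in T_x : |(D_xf^{n})v|\ge C\Lambda^{n}|v| \text{ for all } n\in\mathbb{N}\},$$ for every $x\in M$ one has $T_x=E_x^s\oplus E_x^u$, $D_xf(E_x^s)=E_{f(x)}^s$ and $D_xf(E_x^u)=E_{f(x)}^u$. *)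

(* Defs.v *)
From HB Require Import structures.
From mathcomp Require Import all_boot all_order all_algebra.
From mathcomp Require Import all_classical all_reals all_analysis.
Import Order.TTheory GRing.Theory Num.Theory.
Import numFieldNormedType.Exports.

Set Implicit Arguments.
Unset Strict Implicit.
Unset Printing Implicit Defensive.

Local Open Scope classical_set_scope.
Local Open Scope ring_scope.

Section Hyperbolic.
Variable R : realType.
Implicit Types (f : R -> R) (M : set R) (x : R).

Definition nonwandering f : set R :=
  [set x | forall U : set R, nbhs x U ->
     exists2 n, (0 < n)%N & (iter n f @` U) `&` U !=set0].

Definition smooth f := forall n x, derivable (derive1n n f) x 1.

(* Tangent spaces are the one-dimensional vector space [R^o];
   [tangent (iter n f) x] is the differential of the n-th iterate of f at x. *)
Definition tangent f x : R^o -> R^o := fun v => derive1 f x * v.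

Definition stable f (K L : R) x : set R^o :=
  [set v | forall n, (0 < n)%N ->
     `|tangent (iter n f) x v| <= K * L ^- n * `|v|].

Definition unstable f (C L : R) x : set R^o :=
  [set v | forall n, (0 < n)%N ->
     C * L ^+ n * `|v| <= `|tangent (iter n f) x v|].

(* The tangent space is the internal direct sum of A and B; in particular,
   the sets A and B are linear subspaces. *)
Definition tangent_direct_sum (A B : set R^o) :=
  exists U W : {vspace R^o},
    [/\ [set` U] = A, [set` W] = B,
        (U + W)%VS = fullv & directv (U + W)].

Definition hyperbolic f M :=
  [/\ smooth f,
      f @` M `<=` M &
      exists K C L : R, [/\ 0 < K, 0 < C, 1 < L &
        forall x, M x ->
          [/\ tangent_direct_sum (stable f K L x) (unstable f C L x),
              tangent f x @` stable f K L x = stable f K L (f x) &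
              tangent f x @` unstable f C L x = unstable f C L (f x)]]].

Definition quadratic (c : R) : R -> R := fun x => x ^+ 2 + c.

End Hyperbolic.

(* Main.v *)
Require Import Defs.
From mathcomp Require Import all_boot all_order all_algebra.
From mathcomp Require Import all_classical all_reals all_analysis.
From mathcomp Require Import ring lra.
Import Order.TTheory GRing.Theory Num.Theory.
Import numFieldNormedType.Exports.
Local Open Scope classical_set_scope.
Local Open Scope ring_scope.

(** The non-wandering set is uniformly expanded, so it is hyperbolic with
    trivial stable spaces ([hyperbolic_of_expanding]).

    Expansion is not visible in the Euclidean metric: [2 * x] is less than 1 in
    absolute value near the critical point, and for [c] close to -2 the
    non-wandering set has points there. It is visible in the metric with density
    1 / sqrt (c^2 - x^2) on the interval ]c, -c[: if x and f x both lie in it,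
    the differential at x stretches vectors by a factor at least 2. Squared and
    cleared of denominators this is [quadratic_expansion_step], a polynomial
    inequality that holds on all of the line and can therefore be iterated
    ([quadratic_expansion]).

    The density blows up at c and -c only. Put b = 1 - c / 2, which is
    smaller than -c. Outside [-b, b] the absolute value increases under f by at
    least a fixed amount, so such points escape and are wandering
    ([quadratic_nonwandering_bound]). Hence the non-wandering set, which is
    forward invariant, stays inside [-b, b], where the density is comparable to
    the Euclidean one, and the factor 2 per step passes to the Euclidean metric
    up to a constant ([quadratic_nonwandering_expanding]). *)

(** * Non-wandering sets and expanding invariant sets *)

Lemma nonwandering_invariant (R : realType) (f : R -> R) :
  continuous f -> f @` nonwandering f `<=` nonwandering f.
Proof.
move=> fcont _ [x NWx <-] U /fcont fU.
have [n n_gt0 [z [[y Uy <-] Uz]]] := NWx _ fU.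
exists n => //; exists (iter n f (f y)); split; first by exists (f y).
by rewrite -iterSr.
Qed.

(** With K = C the stable spaces are 0: for a stable vector v, expansion and
    the stable bound at n = 1 give C * L * |v| <= C / L * |v|, so v = 0. The
    unstable spaces are full, and the differential maps them onto each other
    because its multiplier is not 0. *)
Lemma hyperbolic_of_expanding (R : realType) (f : R -> R) (M : set R)
    (C L : R) :
  smooth f -> f @` M `<=` M -> 0 < C -> 1 < L ->
  (forall x n, M x -> (0 < n)%N -> C * L ^+ n <= `|derive1 (iter n f) x|) ->
  hyperbolic f M.
Proof.
move=> fsmooth Minv C_gt0 L_gt1 expand; split=> //; exists C, C, L; split=> //.
have L_gt0 : 0 < L by lra.
have stableE x : M x -> stable f C L x = [set 0].
  move=> Mx; apply/seteqP; split=> [v /(_ 1%N isT)|_ ->]; last first.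
    by move=> n _; rewrite /tangent mulr0 normr0 mulr0.
  rewrite /tangent normrM expr1 => Sv.
  have Uv : C * L * `|v| <= C * L^-1 * `|v|.
    apply: le_trans Sv; rewrite ler_wpM2r//.
    by have := expand x 1%N Mx isT; rewrite expr1.
  apply/eqP; rewrite -normr_le0 leNgt; apply/negP => v_gt0.
  move: Uv; rewrite ler_pM2r// ler_pM2l// leNgt => /negP; apply.
  by apply: lt_trans (L_gt1); rewrite invf_lt1.
have unstableE x : M x -> unstable f C L x = setT.
  move=> Mx; apply/seteqP; split=> // v _ n n_gt0.
  by rewrite /tangent normrM ler_wpM2r// expand.
move=> x Mx; have Mfx : M (f x) by apply: Minv; exists x.
have dfx_neq0 : derive1 f x != 0.
  rewrite -normr_gt0; apply: lt_le_trans (expand x 1%N Mx isT).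
  by rewrite mulr_gt0// exprn_gt0.
rewrite !stableE// !unstableE//; split.
- exists 0%VS, fullv; split.
  + apply/seteqP; split=> v /=; first by rewrite memv0 => /eqP.
    by move=> ->; rewrite mem0v.
  + by apply/seteqP; split=> v //= _; rewrite memvf.
  + by rewrite add0v.
  + by rewrite directvE/= add0v dimv0 add0n.
- by rewrite image_set1 /tangent mulr0.
- apply/seteqP; split=> // v _; exists ((derive1 f x)^-1 * v) => //.
  by rewrite /tangent mulrA divff// mul1r.
Qed.

(** * The quadratic family *)

Lemma smooth_horner (R : realType) (p : {poly R}) : smooth (horner p).
Proof.
move=> n x; suff -> : derive1n n (horner p) = horner p^`(n).
  exact: derivable_horner.
elim: n => [|n IHn]; first by rewrite derivn0.
by rewrite derive1nS IHn derivnS derivE.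
Qed.

Lemma quadraticE (R : realType) (c : R) :
  quadratic c = horner ('X^2 + c%:P).
Proof. by apply/funext => x; rewrite !hornerE. Qed.

Lemma derive1_quadratic (R : realType) (c x : R) :
  derive1 (quadratic c) x = 2 * x.
Proof.
by rewrite quadraticE -derivE derivD derivXn derivC !hornerE mulr_natl.
Qed.

Lemma derivable_iter_quadratic (R : realType) (c : R) n x :
  derivable (iter n (quadratic c)) x 1.
Proof.
elim: n => [|n IHn]; first exact: derivable_id.
apply/derivable1_diffP; apply: differentiable_comp; apply/derivable1_diffP=> //.
Qed.

Lemma derive1_iter_quadraticS (R : realType) (c : R) n x :
  derive1 (iter n.+1 (quadratic c)) x =
  2 * iter n (quadratic c) x * derive1 (iter n (quadratic c)) x.
Proof.
rewrite -(derive1_quadratic _ c) -derive1_comp//.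
exact: derivable_iter_quadratic.
Qed.

(** With f x = x^2 + c one has c^2 - (f x)^2 = x^2 * (- 2 * c - x^2), so the
    claim is that x^2 * (c^2 - x^2) >= x^2 * (- 2 * c - x^2), which follows
    from c^2 >= - 2 * c. *)
Lemma quadratic_expansion_step (R : realType) (c x : R) : c < - 2 ->
  4 * (c ^+ 2 - quadratic c x ^+ 2) <= (2 * x) ^+ 2 * (c ^+ 2 - x ^+ 2).
Proof.
move=> c_lt; rewrite -subr_ge0 /quadratic.
have -> : (2 * x) ^+ 2 * (c ^+ 2 - x ^+ 2)
    - 4 * (c ^+ 2 - (x ^+ 2 + c) ^+ 2) = 4 * x ^+ 2 * (c * (c + 2)) by ring.
by apply: mulr_ge0; [rewrite mulr_ge0// sqr_ge0|rewrite mulr_le0//; lra].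
Qed.

Lemma quadratic_expansion (R : realType) (c x : R) n : c < - 2 ->
  4 ^+ n * (c ^+ 2 - iter n (quadratic c) x ^+ 2) <=
  derive1 (iter n (quadratic c)) x ^+ 2 * (c ^+ 2 - x ^+ 2).
Proof.
move=> c_lt; elim: n => [|n IHn].
  by rewrite (derive1_id x) expr0 expr1n.
rewrite derive1_iter_quadraticS exprMn -mulrA exprSr -mulrA.
set y := iter n _ x in IHn *; rewrite iterS -/y.
apply: (@le_trans _ _ (4 ^+ n * ((2 * y) ^+ 2 * (c ^+ 2 - y ^+ 2)))).
  by rewrite ler_wpM2l ?exprn_ge0//; exact: quadratic_expansion_step.
by rewrite mulrCA ler_wpM2l// sqr_ge0.
Qed.

(** At the threshold t = 1 - c / 2 the gain t^2 + c - t equals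
    c * (c + 2) / 4, and it increases with t beyond 1 / 2. *)
Lemma quadratic_escape_step (R : realType) (c x : R) : c < - 2 ->
  1 - c / 2 <= `|x| -> `|x| + c * (c + 2) / 4 <= `|quadratic c x|.
Proof.
move=> c_lt x_ge; apply: le_trans (ler_norm _).
rewrite /quadratic -(real_normK (num_real x)); nra.
Qed.

Lemma quadratic_escape (R : realType) (c x : R) n : c < - 2 ->
  1 - c / 2 <= `|x| -> (0 < n)%N ->
  `|x| + c * (c + 2) / 4 <= `|iter n (quadratic c) x|.
Proof.
move=> c_lt x_ge; case: n => // n _; elim: n => [|n IHn].
  exact: quadratic_escape_step.
rewrite iterS; set y := iter n.+1 _ x in IHn *.
have gain_gt0 : 0 < c * (c + 2) by rewrite nmulr_rgt0; lra.
have : `|y| + c * (c + 2) / 4 <= `|quadratic c y|.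
  by apply: quadratic_escape_step => //; lra.
lra.
Qed.

(** A point with larger absolute value has a neighbourhood on which the absolute
    value varies by less than the gain of [quadratic_escape], so no orbit
    returns to it. *)
Lemma quadratic_nonwandering_bound (R : realType) (c x : R) : c < - 2 ->
  nonwandering (quadratic c) x -> `|x| <= 1 - c / 2.
Proof.
move=> c_lt NWx; rewrite leNgt; apply/negP => x_gt.
have gain_gt0 : 0 < c * (c + 2) by rewrite nmulr_rgt0; lra.
have norm_near : nbhs x [set y | `| `|x| - `|y| | < c * (c + 2) / 8].
  have e_gt0 : 0 < c * (c + 2) / 8 by lra.
  by have /cvgrPdist_lt/(_ _ e_gt0) := @norm_continuous _ R x.
have norm_gt : nbhs x [set y | 1 - c / 2 < `|y|].
  exact: cvgr_gt (@norm_continuous _ R x) _ x_gt.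
have [n n_gt0 [_ [[y [/= y_near y_gt] <-] [/= z_near _]]]] :=
  NWx _ (filterI norm_near norm_gt).
have := quadratic_escape _ c y n c_lt (ltW y_gt) n_gt0.
move: y_near z_near; rewrite !ltr_norml => /andP[] ? ? /andP[] ? ?; lra.
Qed.

(** With a = - c and b = 1 - c / 2, the constant (c + 2) / (2 * c) is
    (a - b) / a; its square is at most (a^2 - b^2) / a^2, which is the constant
    that [quadratic_expansion] gives for the square of the derivative. *)
Lemma quadratic_nonwandering_expanding (R : realType) (c x : R) n : c < - 2 ->
  nonwandering (quadratic c) x ->
  (c + 2) / (2 * c) * 2 ^+ n <= `|derive1 (iter n (quadratic c)) x|.
Proof.
move=> c_lt NWx; set D := derive1 _ _.
have NW_iter : nonwandering (quadratic c) (iter n (quadratic c) x).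
  elim: n {D} => // n IHn; apply: nonwandering_invariant; last first.
    by exists (iter n (quadratic c) x).
  by rewrite quadraticE; exact: continuous_horner.
have := quadratic_nonwandering_bound _ _ _ c_lt NW_iter.
set y := iter n _ x => y_le.
have := quadratic_expansion _ c x n c_lt; rewrite -/D -/y => expand.
have -> : (c + 2) / (2 * c) = (- (c + 2) / 2) / (- c) by field; lra.
rewrite mulrAC ler_pdivrMr; last lra.
have y2_le : (- (c + 2) / 2) ^+ 2 <= c ^+ 2 - y ^+ 2.
  by rewrite -(real_normK (num_real y)); have := normr_ge0 y; nra.
have pow4 : 4 ^+ n = (2 ^+ n) ^+ 2 :> R by rewrite exprAC expr2 -natrM.
have D2_ge : 4 ^+ n * (- (c + 2) / 2) ^+ 2 <= D ^+ 2 * c ^+ 2.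
  apply: (@le_trans _ _ (4 ^+ n * (c ^+ 2 - y ^+ 2))).
    by rewrite ler_wpM2l// exprn_ge0.
  apply: le_trans expand _; rewrite ler_wpM2l ?sqr_ge0//.
  by rewrite lerBlDr lerDl sqr_ge0.
rewrite -(@ler_pXn2r _ 2)// ?nnegrE; last 2 first.
- by rewrite mulr_ge0// ?exprn_ge0//; lra.
- by rewrite mulr_ge0//; lra.
move: D2_ge; rewrite pow4 -!exprMn mulrC => /le_trans -> //.
by rewrite !exprMn sqrrN real_normK// num_real.
Qed.

Theorem mainTheorem2 (R : realType) (c : R) (hc : c < - 2) :
  hyperbolic (quadratic c) (nonwandering (quadratic c)).
Proof.
apply: (@hyperbolic_of_expanding _ _ _ ((c + 2) / (2 * c)) 2).
- by rewrite quadraticE; exact: smooth_horner.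
- apply: nonwandering_invariant; rewrite quadraticE; exact: continuous_horner.
- by rewrite -mulrNN -invrN divr_gt0; lra.
- by lra.
- by move=> x n NWx _; exact: quadratic_nonwandering_expanding.
Qed.
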